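(* Let $V$ be a vector space of finite dimension $\ell$ over a field $\mathbf{K}$ of characteristic zero, and let $\Delta$ be a finite set of nonzero elements of $V^*$, no two of which are proportional. Then, as formal power series in $s,t$, $$\sum_{p,q}\dim_{\mathbf{K}}(R^p_q)\,s^pt^q=(1-s)^{-\ell-1}(1-t)^{-1}\,\mathrm{Poin}\left(\mathcal{A}(\Delta),\ \frac{t(1-s)}{1-t}\right).$$
   Context: Let $S=S(V^* )$ be the symmetric algebra of $V^*$, regarded as the ring of polynomial functions on $V$. Let $R=R(\Delta)=S[\Delta^{-1}]$ with $\Delta^{-1}=\{1/\alpha\mid\alpha\in\Delta\}$, i.e. the $\mathbf{K}$-algebra of rational functions on $V$ regular outside $\bigcup_{\alpha\in\Delta}\{\alpha=0\}$. For $p,q\in\mathbb{Z}$, let $R^p_q$ be the $\mathbf{K}$-linear span of all elements $f/g\in R$ with $f,g$ polynomials ($g\neq 0$), $\deg f\le p$ and $\deg g\le q$; $R^p_q=0$ if $p<0$ or $q<0$. Let $\mathcal{A}(\Delta)=\{\ker\alpha\mid\alpha\in\Delta\}$, a central hyperplane arrangement in $V$. Let $L=L(\Delta)$ be the set of all intersections of (possibly empty) subfamilies of $\mathcal{A}(\Delta)$ (the empty intersection being $V$), partially ordered by reverse inclusion: $X\le Y\iff X\supseteq Y$. The Möbius function $\mu:L\to\mathbb{Z}$ is characterized by $\mu(V)=1$ and $\sum_{Y\le X}\mu(Y)=0$ for every $X\in L$ with $X\neq V$ (i.e. $V<X$). The Poincaré polynomial of $\mathcal{A}(\Delta)$ is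 $$\mathrm{Poin}(\mathcal{A}(\Delta),t)=\sum_{X\in L}\mu(X)(-t)^{\operatorname{codim}X}.$$ *)

(* Defs.v *)
From HB Require Import structures.
From mathcomp Require Import all_boot all_order all_algebra.
From mathcomp Require Import fraction finmap mpoly.
From mathcomp Require Import boolp.

Set Implicit Arguments.
Unset Strict Implicit.
Unset Printing Implicit Defensive.

Import Order.TTheory GRing.Theory Num.Theory.
Local Open Scope ring_scope.

(* Univariate formal power series, given by their coefficient sequences, with *)
(* the Cauchy product.                                                        *)

Definition fps (R : Type) : Type := nat -> R.

HB.instance Definition _ (R : choiceType) := Choice.copy (fps R) (nat -> R).

Section FpsRing.
Variable R : comNzRingType.
Implicit Types f g h : fps R.

Definition fpsC (c : R) : fps R := fun n => if n == 0%N then c else 0.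
Definition fpsX : fps R := fun n => (n == 1%N)%:R.
Definition fps_add f g : fps R := fun n => f n + g n.
Definition fps_opp f : fps R := fun n => - f n.
Definition fps_mul f g : fps R := fun n => \sum_(i < n.+1) f i * g (n - i)%N.

Fact fps_addA : associative fps_add.
Proof. by move=> f g h; apply: funext => n; exact: addrA. Qed.
Fact fps_addC : commutative fps_add.
Proof. by move=> f g; apply: funext => n; exact: addrC. Qed.
Fact fps_add0 : left_id (fun=> 0) fps_add.
Proof. by move=> f; apply: funext => n; exact: add0r. Qed.
Fact fps_addN : left_inverse (fun=> 0) fps_opp fps_add.
Proof. by move=> f; apply: funext => n; exact: addNr. Qed.

HB.instance Definition _ :=
  GRing.isZmodule.Build (fps R) fps_addA fps_addC fps_add0 fps_addN.

Let trunc N f : {poly R} := \poly_(i < N) f i.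

Let fps_mul_trunc N f g n : (n < N)%N ->
  fps_mul f g n = (trunc N f * trunc N g)`_n.
Proof.
move=> ltnN; rewrite coefM; apply: eq_bigr => i _; rewrite !coef_poly.
have lei : (i <= n)%N by rewrite -ltnS.
by rewrite (leq_ltn_trans lei ltnN) (leq_ltn_trans (leq_subr _ _) ltnN).
Qed.

Fact fps_mulC : commutative fps_mul.
Proof.
by move=> f g; apply: funext => n; rewrite !(@fps_mul_trunc n.+1) // mulrC.
Qed.

Fact fps_mulA : associative fps_mul.
Proof.
move=> f g h; apply: funext => n.
transitivity ((trunc n.+1 f * (trunc n.+1 g * trunc n.+1 h))`_n).
  rewrite coefM; apply: eq_bigr => i _; rewrite coef_poly ltn_ord.
  by rewrite (@fps_mul_trunc n.+1) // ltnS leq_subr.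
rewrite mulrA coefM; apply: eq_bigr => i _.
by rewrite coef_poly ltnS leq_subr (@fps_mul_trunc n.+1).
Qed.

Fact fps_mul1 : left_id (fpsC 1) fps_mul.
Proof.
move=> f; apply: funext => n; rewrite /fps_mul big_ord_recl /= subn0 mul1r.
by rewrite big1 ?addr0 // => i _; rewrite mul0r.
Qed.

Fact fps_mulDl : left_distributive fps_mul fps_add.
Proof.
move=> f g h; apply: funext => n; rewrite /fps_mul /fps_add -big_split /=.
by apply: eq_bigr => i _; rewrite mulrDl.
Qed.

Fact fps_1neq0 : fpsC 1 != 0.
Proof.
by apply/eqP => /(congr1 (fun f : fps R => f 0%N)) /eqP; rewrite /= oner_eq0.
Qed.

HB.instance Definition _ :=
  GRing.Zmodule_isComNzRing.Build (fps R)
    fps_mulA fps_mulC fps_mul1 fps_mulDl fps_1neq0.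

End FpsRing.

Section FpsUnit.
Variable R : comUnitRingType.
Implicit Types f g : fps R.

Definition fps_unit : {pred fps R} := fun f => f 0%N \is a GRing.unit.

(* The first n coefficients of f^-1, when f 0 is invertible. *)
Fixpoint fps_inv_seq f (n : nat) : seq R :=
  if n is n'.+1 then
    let s := fps_inv_seq f n' in
    rcons s ((f 0%N)^-1 * ((n' == 0%N)%:R - \sum_(i < n') s`_i * f (n' - i)%N))
  else [::].

Definition fps_inv f : fps R :=
  if fps_unit f then fun n => (fps_inv_seq f n.+1)`_n else f.

Let size_inv_seq f n : size (fps_inv_seq f n) = n.
Proof. by elim: n => //= n IHn; rewrite size_rcons IHn. Qed.

Let nth_inv_seq f n i : (i < n)%N ->
  (fps_inv_seq f n)`_i = (fps_inv_seq f i.+1)`_i.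
Proof.
elim: n => // n IHn; rewrite ltnS leq_eqVlt => /predU1P[-> // | ltin].
by rewrite [in LHS]/= nth_rcons size_inv_seq ltin IHn.
Qed.

Fact fps_mulV : {in fps_unit, left_inverse 1 fps_inv *%R}.
Proof.
move=> f Uf; apply: funext => n; rewrite /fps_inv [fps_unit f]Uf.
transitivity (\sum_(i < n.+1) (fps_inv_seq f i.+1)`_i * f (n - i)%N) => //.
rewrite big_ord_recr subnn.
under eq_bigr => i _ do rewrite -(nth_inv_seq f (ltn_ord i)).
rewrite /= nth_rcons size_inv_seq ltnn eqxx mulrAC mulVr // mul1r addrC subrK.
by case: n.
Qed.

Fact fps_unitPl f g : g * f = 1 -> fps_unit f.
Proof.
move=> /(congr1 (fun h : fps R => h 0%N)).
rewrite /GRing.mul /= /fps_mul big_ord1 /= => gf1.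
by apply/unitrP; exists (g 0%N); split=> //; rewrite mulrC.
Qed.

Fact fps_inv_out : {in [predC fps_unit], fps_inv =1 id}.
Proof. by move=> f nUf; rewrite /fps_inv ifN. Qed.

HB.instance Definition _ :=
  GRing.ComNzRing_hasMulInverse.Build (fps R) fps_mulV fps_unitPl fps_inv_out.

End FpsUnit.

(* Z[[s,t]] is (Z[[t]])[[s]]: the coefficient of s^p t^q in F is F p q.       *)
Definition fps2 : Type := fps (fps int).
HB.instance Definition _ := GRing.ComUnitRing.on fps2.

Definition ser_s : fps2 := fpsX (fps int).
Definition ser_t : fps2 := fpsC (fpsX int).
Definition ser_of (c : nat -> nat -> int) : fps2 := c.

Lemma ser_1s_unit : 1 - ser_s \is a GRing.unit.
Proof.
change ((1 - ser_s : fps (fps int)) 0%N \is a GRing.unit).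
have -> : (1 - ser_s : fps (fps int)) 0%N = 1 by exact: subr0.
exact: unitr1.
Qed.

Lemma ser_1t_unit : 1 - ser_t \is a GRing.unit.
Proof.
change ((1 - ser_t : fps (fps int)) 0%N 0%N \is a GRing.unit).
have -> : (1 - ser_t : fps (fps int)) 0%N 0%N = 1 by exact: subr0.
exact: unitr1.
Qed.

Section LinearSpan.
Variables (K : fieldType) (M : lmodType K).

Definition Kspan (A : M -> Prop) (x : M) : Prop :=
  exists (n : nat) (c : 'I_n -> K) (a : 'I_n -> M),
    (forall i, A (a i)) /\ x = \sum_(i < n) c i *: a i.

(* W has a basis with d elements; in particular W is a subspace of M.         *)
Definition has_dimension (W : M -> Prop) (d : nat) : Prop :=
  exists b : 'I_d -> M,
    (forall c : 'I_d -> K, \sum_(i < d) c i *: b i = 0 -> forall i, c i = 0) /\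
    (forall x, W x <-> exists c : 'I_d -> K, x = \sum_(i < d) c i *: b i).

End LinearSpan.

(* S(V^dual) is the polynomial ring on the coordinate functions of the basis  *)
(* vbasis fullv of V, and linform embeds V^dual as its degree-one part.       *)
Notation symalg K V := {mpoly K[\dim {:V}]}.

Section RationalFunctions.
Variables (K : fieldType) (V : vectType K).

Definition linform (alpha : 'Hom(V, K^o)) : symalg K V :=
  \sum_(i < \dim {:V}) alpha (vbasis {:V})`_i *: 'X_i.

Lemma linformE (alpha : 'Hom(V, K^o)) (v : V) :
  (linform alpha).@[fun i => coord (vbasis {:V}) i v] = alpha v.
Proof.
rewrite {2}(coord_vbasis (memvf v)) /linform !linear_sum /=.
by apply: eq_bigr => i _; rewrite mevalZ mevalXU [RHS]linearZ mulrC.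
Qed.

Definition ratfun : Type := {fraction symalg K V}.
HB.instance Definition _ := GRing.Field.on ratfun.

Definition ratfun_scale (c : K) (x : ratfun) : ratfun :=
  tofrac (c%:MP : symalg K V) * x.

Fact ratfun_scaleA a b x :
  ratfun_scale a (ratfun_scale b x) = ratfun_scale (a * b) x.
Proof. by rewrite /ratfun_scale mulrA -rmorphM /= -mpolyCM. Qed.
Fact ratfun_scale1 : left_id 1 ratfun_scale.
Proof. by move=> x; rewrite /ratfun_scale mpolyC1 rmorph1 mul1r. Qed.
Fact ratfun_scaleDr : right_distributive ratfun_scale +%R.
Proof. by move=> a x y; exact: mulrDr. Qed.
Fact ratfun_scaleDl x : {morph ratfun_scale^~ x : a b / a + b}.
Proof. by move=> a b; rewrite /ratfun_scale mpolyCD rmorphD mulrDl. Qed.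

HB.instance Definition _ := GRing.Zmodule_isLmodule.Build K ratfun
  ratfun_scaleA ratfun_scale1 ratfun_scaleDr ratfun_scaleDl.

Definition polfun (f : symalg K V) : ratfun := tofrac f.

End RationalFunctions.

Section Filtration.
Variables (K : fieldType) (V : vectType K) (Delta : {fset 'Hom(V, K^o)}).

(* S[Delta^-1], as the subalgebra of the field of rational functions          *)
(* generated by S and the inverses of the elements of Delta.                  *)
Inductive Ralg : ratfun V -> Prop :=
  | Ralg_pol (f : symalg K V) : Ralg (polfun f)
  | Ralg_inv (alpha : 'Hom(V, K^o)) :
      alpha \in Delta -> Ralg (polfun (linform alpha))^-1
  | Ralg_add (x y : ratfun V) : Ralg x -> Ralg y -> Ralg (x + y)
  | Ralg_mul (x y : ratfun V) : Ralg x -> Ralg y -> Ralg (x * y).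

(* msize f is deg f + 1 if f != 0, and msize 0 = 0.                           *)
Definition deg_le (f : symalg K V) (p : int) : bool := (msize f)%:Z <= p + 1.

(* For p < 0 or q < 0 this is the zero subspace, see Rpq_neg.                 *)
Definition Rpq (p q : int) : ratfun V -> Prop :=
  Kspan (fun x => Ralg x /\
    exists f g : symalg K V,
      [/\ g != 0, deg_le f p, deg_le g q & x = polfun f / polfun g]).

Lemma Rpq_neg (p q : int) (x : ratfun V) :
  p < 0 \/ q < 0 -> Rpq p q x <-> x = 0.
Proof.
have deg0 (f : symalg K V) r : r < 0 -> deg_le f r -> f = 0.
  move=> r0 fr; apply/eqP; rewrite -msize_poly_eq0 -leqn0 -lez_nat.
  by apply: le_trans fr _; rewrite lezD1.
move=> pq0; split=> [[n [c [a [Aa ->]]]] | ->]; last first.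
  by exists 0%N, (fun=> 0), (fun=> 0); split=> [[]|]; rewrite ?big_ord0.
rewrite big1 // => i _; have [_ [f [g [g0 fp gq ->]]]] := Aa i.
case: pq0 => [p0 | q0]; last by rewrite (deg0 _ _ q0 gq) eqxx in g0.
by rewrite (deg0 _ _ p0 fp) /polfun rmorph0 mul0r scaler0.
Qed.

End Filtration.

Section Arrangement.
Variables (K : fieldType) (V : vectType K).
Implicit Types (L : {fset {vspace V}}) (X Y : {vspace V}).

Definition arrangement (Delta : {fset 'Hom(V, K^o)}) : {fset {vspace V}} :=
  [fset lker alpha | alpha in Delta]%fset.

Definition intersections (A : {fset {vspace V}}) : {fset {vspace V}} :=
  [fset (\bigcap_(H <- (B : {fset {vspace V}})) H)%VS | B in fpowerset A]%fset.

Definition codimv X : nat := (\dim {:V} - \dim X)%N.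

(* The order is reverse inclusion.                                            *)
Definition leL X Y : bool := (Y <= X)%VS.

(* The fuel n, an upper bound on codimv X, only serves termination.           *)
Fixpoint mobius_rec (n : nat) L X : int :=
  if X == fullv then 1 else
  if n is n'.+1 then - \sum_(Y <- L | leL Y X && (Y != X)) mobius_rec n' L Y
  else 0.

Definition mobius L X : int := mobius_rec (codimv X) L X.

Lemma mobiusT L : mobius L fullv = 1.
Proof. by rewrite /mobius; case: (codimv _) => [|n] /=; rewrite eqxx. Qed.

Let codim_lt X Y : leL Y X -> Y != X -> (codimv Y < codimv X)%N.
Proof.
rewrite /leL => XY nYX.
have ltXY : (\dim X < \dim Y)%N.
  rewrite ltn_neqAle dimvS // andbT; apply: contra nYX => /eqP dXY.
  by rewrite eq_sym eqEdim XY dXY leqnn.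
by apply: ltn_sub2l => //; rewrite (leq_trans ltXY) // dimvS ?subvf.
Qed.

Let mobius_recE n L X : (codimv X <= n)%N -> mobius_rec n L X = mobius L X.
Proof.
rewrite /mobius; elim/ltn_ind: n X => [[|n]] IH X leXn.
  by move: leXn; rewrite leqn0 => /eqP ->.
case codE: (codimv X) => [|m] /=.
  suff -> : X == fullv by [].
  by rewrite eqEdim subvf -subn_eq0 -/(codimv X) codE.
case: eqP => // _; congr (- _); apply: eq_bigr => Y /andP[XY nYX].
have ltYX := codim_lt XY nYX; rewrite codE ltnS in ltYX.
have lemn : (m <= n)%N by rewrite codE in leXn.
by rewrite !IH ?(leq_trans ltYX) ?ltnS.
Qed.

Lemma mobius_sum L X : X \in L -> X != fullv ->
  \sum_(Y <- L | leL Y X) mobius L Y = 0.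
Proof.
move=> LX nXT; rewrite big_mkcond (bigD1_seq X) ?fset_uniq //= -big_mkcondr.
rewrite /leL subvv {1}/mobius; case codE: (codimv X) => [|m] /=.
  by case/negP: nXT; rewrite eqEdim subvf -subn_eq0 -/(codimv X) codE.
rewrite (negPf nXT) addrC; apply/eqP; rewrite subr_eq0; apply/eqP.
apply: eq_big => [Y | Y /andP[nYX XY]]; first by rewrite andbC.
by rewrite mobius_recE // -ltnS -codE codim_lt.
Qed.

Definition Poin (A : {fset {vspace V}}) : {poly int} :=
  let L := intersections A in
  \sum_(X <- L) (mobius L X)%:P * (- 'X) ^+ codimv X.

End Arrangement.

(* Main.v *)
Require Import Defs.
From HB Require Import structures.
From mathcomp Require Import all_boot all_order all_algebra.
From mathcomp Require Import fraction finmap mpoly.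
From mathcomp Require Import ring.

Set Implicit Arguments.
Unset Strict Implicit.
Unset Printing Implicit Defensive.

Import Order.TTheory GRing.Theory Num.Theory.
Local Open Scope ring_scope.

(** The space R^p_q has an explicit basis, and counting it gives the series.

    Write s for the list of forms.  Clearing common factors, which are linear
    forms and hence primes of S, shows that R^p_q is spanned by the fractions
    f / (a_1 ... a_m) with deg f <= p, all a_i in s and m <= q ([Rpq_fracs]).
    By partial fractions the denominators can be brought into the shape
    a_1^k_1 ... a_r^k_r with all k_i > 0, where a_1, ..., a_r is one of the
    no-broken-circuit sets of s, and the numerator can be reduced modulo
    a_1, ..., a_r, that is, to a polynomial in dim X coordinates on the flat
    X = ker a_1 :&: ... :&: ker a_r.

    This family is built by deletion and restriction, for a pair (X, s) with X a
    subspace of V on which the forms of s are to be restricted ([nbc]).  Let a be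
    the head of s.  If a vanishes on X the family is empty; otherwise it is the
    family of (X, tail of s) together with the elements x / a^k, k > 0, for x in
    the family of (X :&: ker a, tail of s).  All its members are rational
    functions on V itself: instead of passing to quotients, one works modulo
    the forms that vanish on X.
    - It spans modulo the forms vanishing on X ([fracs_reduced]): a form that
      vanishes on X :&: ker a is the sum of one vanishing on X and of a multiple
      of a, and the multiple of a lowers the pole order along ker a.
    - It is free modulo functions vanishing on X ([nbc_free]): in a relation
      x_0 + x_1 / a + x_2 / a^2 + ... = 0, where x_k for k > 0 comes from the
      restricted family, multiplying by a and restricting to ker a isolates the
      coefficients one pole order after the other.
    For X = V, these say that the family is a basis ([fracs_dimension]).

    The recursion turns the number of elements into a generating function: up
    to the factor (1-s)^(-dim X-1) (1-t)^(-1), in the variables s and t of the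
    series, it is a polynomial [poin_rec] in u = t(1-s)/(1-t) obeying
    P(X, a :: l) = P(X, l) + u P(X :&: ker a, l) when a is nonzero on X
    ([nbc_serE]).  That this polynomial is the Poincare polynomial when X = V is
    Whitney's theorem: the Moebius function at Y is the alternating number of
    subsets of s whose kernels intersect in Y ([mobiusE], [PoinE]). *)

(** * Linear spans *)

Section Kspan.
Variables (K : fieldType) (M : lmodType K).
Implicit Types (A B W : M -> Prop) (x y : M) (c : K).

Lemma Kspan_mem A x : A x -> Kspan A x.
Proof.
move=> Ax; exists 1%N, (fun=> 1), (fun=> x); split=> //.
by rewrite big_ord1 scale1r.
Qed.

Lemma Kspan_ind A W x :
  W 0 -> (forall c x y, A x -> W y -> W (c *: x + y)) -> Kspan A x -> W x.
Proof.
move=> W0 WD [n [c [a [Aa ->]]]]; elim: n c a Aa => [|n IH] c a Aa.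
  by rewrite big_ord0.
by rewrite big_ord_recl; apply: WD => //; apply: IH => i; apply: Aa.
Qed.

Lemma Kspan0 A : Kspan A 0.
Proof.
by exists 0%N, (fun=> 0), (fun=> 0); split=> [[]|] //; rewrite big_ord0.
Qed.

Lemma KspanD A x y : Kspan A x -> Kspan A y -> Kspan A (x + y).
Proof.
move=> [n [c [a [Aa ->]]]] [m [d [b [Bb ->]]]].
exists (n + m)%N, (fun i => match split i with inl j => c j | inr j => d j end),
  (fun i => match split i with inl j => a j | inr j => b j end); split.
  by move=> i; case: (split i).
rewrite big_split_ord; congr (_ + _); apply: eq_bigr => i _.
  by rewrite -[lshift m i]/(unsplit (inl i)) unsplitK.
by rewrite -[rshift n i]/(unsplit (inr i)) unsplitK.
Qed.

Lemma KspanZ A c x : Kspan A x -> Kspan A (c *: x).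
Proof.
move=> [n [d [a [Aa ->]]]]; exists n, (fun i => c * d i), a; split=> //.
by rewrite scaler_sumr; apply: eq_bigr => i _; rewrite scalerA.
Qed.

Lemma Kspan_sub A B x : (forall y, A y -> Kspan B y) -> Kspan A x -> Kspan B x.
Proof.
move=> AB; apply: Kspan_ind => [|c y z /AB Ay Az]; first exact: Kspan0.
exact/KspanD/Az/KspanZ.
Qed.

Lemma Kspan_sum A (I : Type) (r : seq I) (P : pred I) (F : I -> M) :
  (forall i, P i -> Kspan A (F i)) -> Kspan A (\sum_(i <- r | P i) F i).
Proof.
by move=> AF; apply: big_rec => [|i x /AF ? ?]; [exact: Kspan0 | exact: KspanD].
Qed.

End Kspan.

(** * Polynomials and monomials *)

Section Monomials.
Variables (K : fieldType).

(** Carries the degree along, so that statements bounding degrees can be proved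
    one variable at a time. *)
Lemma mpolyX_ind n (P : nat -> {mpoly K[n]} -> Prop) :
  P 0%N 1 -> (forall d i f, P d f -> P d.+1 ('X_i * f)) ->
  forall m, P (mdeg m) 'X_[m].
Proof.
move=> P1 PX m; have [d md] : exists d, mdeg m = d by exists (mdeg m).
rewrite md; elim: d m md => [|d IH] m md.
  by move/eqP: md; rewrite mdeg_eq0 => /eqP ->; rewrite mpolyX0.
have [i mi] : exists i, m i != 0%N.
  apply/existsP; apply: contra_eqT md; rewrite negb_exists => /forallP m0.
  by rewrite mdegE big1 // => i _; exact/eqP/negbNE/m0.
have Um : (U_(i) <= m)%MM.
  by apply/mnm_lepP => j; rewrite mnm1E; case: eqP => // <-; rewrite lt0n.
move: md; rewrite -(submK Um) mdegD mdeg1 addn1 => -[md].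
by rewrite addmC mpolyXD; apply/PX/IH.
Qed.

Lemma eq_mpoly_rmorph n (R : comNzRingType)
    (f g : {rmorphism {mpoly K[n]} -> R}) :
  (forall c, f c%:MP = g c%:MP) -> (forall i, f 'X_i = g 'X_i) -> f =1 g.
Proof.
move=> fgC fgX p; rewrite [p]mpolyE !rmorph_sum; apply: eq_bigr => m _.
rewrite -mul_mpolyC !rmorphM fgC; congr (_ * _).
apply: (@mpolyX_ind n (fun _ p => f p = g p)) => [|_ i q IH].
  by rewrite !rmorph1.
by rewrite !rmorphM fgX IH.
Qed.

Lemma msize_mul1 n d (f g : {mpoly K[n]}) :
  (msize f <= 2)%N -> (msize g <= d.+1)%N -> (msize (f * g) <= d.+2)%N.
Proof.
move=> f2 gd; have [->|f0] := eqVneq f 0; first by rewrite mul0r msize0.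
have [->|g0] := eqVneq g 0; first by rewrite mulr0 msize0.
by rewrite msizeM // -subn1 leq_subLR add1n (leq_add f2 gd).
Qed.

End Monomials.

(** * Restriction of polynomial functions to a subspace *)

Section Restriction.
Variables (K : fieldType) (V : vectType K).
Local Notation E := 'Hom(V, K^o).
Local Notation S := (symalg K V).
Implicit Types (a u : E) (X Y : {vspace V}).

(** The restriction of a to X, in the coordinates of vbasis X. *)
Definition restr_form X a : {mpoly K[\dim X]} :=
  \sum_(i < \dim X) a (vbasis X)`_i *: 'X_i.

(** The i-th coordinate of X, extended to V by the choice built into coord; the
    extensions make [inflate] below a section of [restrict]. *)
Definition extend X (i : 'I_(\dim X)) : E :=
  linfun (coord (vbasis X) i : V -> K^o).

(** Restriction S(V^dual) -> S(X^dual).  The ideal of X is its kernel, and is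
    prime because the target is a domain. *)
Definition restrict X : S -> {mpoly K[\dim X]} :=
  comp_mpoly [tuple restr_form X (extend j) | j < \dim {:V}].
HB.instance Definition _ X := GRing.LRMorphism.on (restrict X).

Definition inflate X : {mpoly K[\dim X]} -> S :=
  comp_mpoly [tuple linform (extend i) | i < \dim X].
HB.instance Definition _ X := GRing.LRMorphism.on (@inflate X).

Lemma extendE X i v : @extend X i v = coord (vbasis X) i v.
Proof. by rewrite lfunE. Qed.

Fact restr_form_is_linear X : linear (restr_form X).
Proof.
move=> c a b; rewrite /restr_form scaler_sumr -big_split; apply: eq_bigr => i _ /=.
by rewrite add_lfunE scale_lfunE scalerDl scalerA.
Qed.
HB.instance Definition _ X :=
  GRing.isLinear.Build K E {mpoly K[\dim X]} _ (restr_form X) (restr_form_is_linear X).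

HB.instance Definition _ :=
  GRing.isLinear.Build K E S _ (@linform K V) (restr_form_is_linear fullv).

Lemma linform_restr a : linform a = restr_form fullv a. Proof. by []. Qed.

Lemma restrictX X j : restrict X 'X_j = restr_form X (extend j).
Proof. by rewrite /restrict comp_mpolyXU -tnth_nth tnth_mktuple. Qed.

Lemma inflateX X i : inflate 'X_i = linform (@extend X i).
Proof. by rewrite /inflate comp_mpolyXU -tnth_nth tnth_mktuple. Qed.

Lemma linform_extend j : linform (@extend fullv j) = 'X_j.
Proof.
rewrite /linform (bigD1 j) //= big1 ?addr0 => [|i /negPf ij].
  by rewrite extendE coord_free ?eqxx ?scale1r // (basis_free (vbasisP _)).
by rewrite extendE coord_free ?ij ?scale0r // (basis_free (vbasisP _)).
Qed.

Lemma hom_coord a : a = \sum_(j < \dim {:V}) a (vbasis {:V})`_j *: extend j.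
Proof.
apply/lfunP => v; rewrite {1}(coord_vbasis (memvf v)) sum_lfunE linear_sum.
by apply: eq_bigr => j _; rewrite scale_lfunE extendE linearZ; exact: mulrC.
Qed.

Lemma restrict_linform X a : restrict X (linform a) = restr_form X a.
Proof.
rewrite {2}(hom_coord a) /linform !linear_sum; apply: eq_bigr => j _.
by rewrite !linearZ; congr (_ *: _); exact: restrictX.
Qed.

Lemma restr_form_eq0 X a : (restr_form X a == 0) = (X <= lker a)%VS.
Proof.
apply/eqP/subvP => [a0 v Xv | a0]; last first.
  apply: big1 => i _; suff /a0 : (vbasis X)`_i \in X.
    by rewrite memv_ker => /eqP ->; rewrite scale0r.
  by apply/vbasis_mem/mem_nth; rewrite size_tuple.
rewrite memv_ker (coord_vbasis Xv) linear_sum big1 // => i _.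
suff ai : a (vbasis X)`_i = 0 by rewrite linearZ /= [a _]ai scaler0.
move/(congr1 (mcoeff U_(i))): a0; rewrite raddf_sum mcoeff0 (bigD1 i) //=.
rewrite mcoeffZ mcoeffX eqxx mulr1 big1 ?addr0 // => j /negPf ji.
by rewrite mcoeffZ mcoeffX eq_mnm1 ji mulr0.
Qed.

Lemma linform_eq0 a : (linform a == 0) = (a == 0).
Proof.
rewrite linform_restr restr_form_eq0; apply/idP/eqP => [/subvP a0 | ->].
  by apply/lfunP => v; rewrite lfunE; apply/eqP; rewrite -memv_ker a0 ?memvf.
by apply/subvP => v _; rewrite memv_ker lfunE.
Qed.

Lemma msize_restr_form X a : (msize (restr_form X a) <= 2)%N.
Proof.
rewrite (leq_trans (msize_sum _ _ _)) //; apply/bigmax_leqP => i _.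
by rewrite (leq_trans (msizeZ_le _ _)) // msizeX mdeg1.
Qed.

Lemma msize_linform a : (msize (linform a) <= 2)%N.
Proof. exact: msize_restr_form. Qed.

Lemma inflateK X : cancel (@inflate X) (restrict X).
Proof.
move=> g; apply: (@eq_mpoly_rmorph _ _ _ (restrict X \o @inflate X) idfun) => [c|i] /=.
  by rewrite /inflate /restrict !comp_mpolyC.
rewrite inflateX restrict_linform /restr_form (bigD1 i) //= big1 ?addr0 => [|j /negPf ij].
  by rewrite extendE coord_free ?eqxx ?scale1r // (basis_free (vbasisP _)).
by rewrite extendE coord_free ?ij ?scale0r // (basis_free (vbasisP _)).
Qed.

Definition project X a : E := \sum_(i < \dim X) a (vbasis X)`_i *: extend i.

Lemma inflate_restr_form X a : inflate (restr_form X a) = linform (project X a).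
Proof.
rewrite /restr_form linear_sum /project [RHS]linear_sum; apply: eq_bigr => i _.
by rewrite !linearZ /= inflateX.
Qed.

Lemma project_sub X a : (X <= lker (a - project X a))%VS.
Proof.
apply/subvP => v Xv; rewrite memv_ker lfunE /= lfunE /= subr_eq0.
rewrite {1}(coord_vbasis Xv) linear_sum sum_lfunE; apply/eqP.
by apply: eq_bigr => i _; rewrite scale_lfunE extendE linearZ; exact: mulrC.
Qed.

(** Both sides agree on linear forms, as a form and its extension from X have
    the same values on Y. *)
Lemma restrict_factor X Y f : (Y <= X)%VS ->
  restrict Y f = restrict Y (inflate (restrict X f)).
Proof.
move=> YX; apply: (@eq_mpoly_rmorph _ _ _ (restrict Y)
  (restrict Y \o @inflate X \o restrict X)) => [c|j] /=.
  by rewrite /inflate /restrict !comp_mpolyC.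
rewrite [in RHS]restrictX inflate_restr_form -{1}linform_extend !restrict_linform.
apply/eqP; rewrite -subr_eq0 -linearB restr_form_eq0.
exact/(subv_trans YX)/project_sub.
Qed.

Lemma restrict_mono X Y f : (Y <= X)%VS -> restrict X f = 0 -> restrict Y f = 0.
Proof. by move=> /restrict_factor-> ->; rewrite !linear0. Qed.

(** The part of the ideal of X with controlled degrees: the cofactors of the
    forms vanishing on X have degree at most p. *)
Definition linear_ideal X p : S -> Prop := Kspan (fun x : S =>
  exists u h, [/\ (X <= lker u)%VS, (msize h <= p.+1)%N & x = linform u * h]).

Lemma msize_restrict X f : (msize (restrict X f) <= msize f)%N.
Proof.
rewrite {1}[f]mpolyE linear_sum; apply: leq_trans (msize_sum _ _ _) _.
apply/bigmax_leqP_seq => m fm _; rewrite linearZ /=.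
apply: leq_trans (msizeZ_le _ _) (leq_trans _ (msize_mdeg_lt fm)).
apply: (@mpolyX_ind _ _ (fun d g => msize (restrict X g) <= d.+1)%N) => [|d i g IH].
  by rewrite rmorph1 msize1.
by rewrite rmorphM /= restrictX; apply: msize_mul1 => //; exact: msize_restr_form.
Qed.

(** Modulo the forms vanishing on X, every polynomial is one in the dim X
    extended coordinates.  One variable x = b + (x - b) is replaced at a time,
    where b is the extension of the restriction of x to X; this never raises
    the degree. *)
Lemma restrict_decomp X p f : (msize f <= p.+1)%N ->
  linear_ideal X p (f - inflate (restrict X f)).
Proof.
move=> fp; have -> : f - inflate (restrict X f) =
    \sum_(m <- msupp f) f@_m *: ('X_[m] - inflate (restrict X 'X_[m])).
  rewrite {1 2}[f]mpolyE [restrict X _]linear_sum [inflate _]linear_sum -sumrB.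
  by apply: eq_bigr => m _; rewrite scalerBr -!linearZ.
rewrite big_seq_cond; apply: Kspan_sum => m /andP[fm _]; apply: KspanZ.
have {f fp fm} mp := leq_trans (msize_mdeg_lt fm) fp.
suff: linear_ideal X (mdeg m) ('X_[m] - inflate (restrict X 'X_[m])).
  apply: Kspan_sub => _ [u [h [Xu hm ->]]]; apply: Kspan_mem.
  by exists u, h; split=> //; apply: leq_trans hm mp.
apply: (@mpolyX_ind _ _ (fun d g => linear_ideal X d (g - inflate (restrict X g))
  /\ (msize g <= d.+1)%N) _ _ m).1.
  by rewrite !rmorph1 subrr msize1; split=> //; exact: Kspan0.
move=> d i g [IH gd]; split; last first.
  by rewrite -linform_extend; apply: msize_mul1 => //; exact: msize_linform.
rewrite !rmorphM /= restrictX inflate_restr_form -linform_extend.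
set a := extend i; set b := project X a.
set g' := inflate _.
have -> : linform a * g - linform b * g'
  = linform (a - b) * g + linform b * (g - g') by rewrite [in RHS]linearB; ring.
apply: KspanD.
  by apply: Kspan_mem; exists (a - b), g; rewrite project_sub leqW.
rewrite {gd}; elim/Kspan_ind: IH => [|c x y [u [h [Xu hd ->]]] IH].
  by rewrite mulr0; exact: Kspan0.
rewrite mulrDr -scalerAr; apply: KspanD => //; apply/KspanZ/Kspan_mem.
exists u, (linform b * h); split=> //; last by rewrite mulrCA.
by apply: msize_mul1 => //; exact: msize_linform.
Qed.

End Restriction.

(** * Fractions over products of linear forms *)

Section Fractions.
Variables (K : fieldType) (V : vectType K).
Local Notation E := 'Hom(V, K^o).
Local Notation S := (symalg K V).
Local Notation F := (ratfun V).
Implicit Types (a u : E) (X Y : {vspace V}) (s t : seq E) (x y : F).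

HB.instance Definition _ := GRing.RMorphism.copy (@polfun K V) (@tofrac S).

Lemma ratfun_scaleE (c : K) x : c *: x = polfun c%:MP * x. Proof. by []. Qed.

Lemma polfunZ c (f : S) : polfun (c *: f) = c *: polfun f.
Proof. by rewrite ratfun_scaleE -rmorphM mul_mpolyC. Qed.

HB.instance Definition _ :=
  GRing.isScalable.Build K S F _ (@polfun K V) polfunZ.

Lemma polfun_eq0 (f : S) : (polfun f == 0) = (f == 0).
Proof. exact: tofrac_eq0. Qed.

Lemma polfun_inj : injective (@polfun K V).
Proof. by move=> f g /eqP; rewrite tofrac_eq => /eqP. Qed.

Lemma rat_scalerAl c x y : c *: (x * y) = (c *: x) * y.
Proof. by rewrite !ratfun_scaleE mulrA. Qed.

Lemma rat_scalerAr c x y : c *: (x * y) = x * (c *: y).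
Proof. by rewrite !ratfun_scaleE mulrCA. Qed.

Lemma Kspan_mul (A B : F -> Prop) x y :
  (forall z, A z -> Kspan B (x * z)) -> Kspan A y -> Kspan B (x * y).
Proof.
move=> AB; elim/Kspan_ind => [|c z w /AB Bz Bw].
  by rewrite mulr0; exact: Kspan0.
by rewrite mulrDr -rat_scalerAr; apply/KspanD/Bw/KspanZ.
Qed.

Definition lin a : F := polfun (linform a).

Fact lin_is_linear : linear lin.
Proof. by move=> c a b; rewrite /lin !linearP. Qed.
HB.instance Definition _ := GRing.isLinear.Build K E F _ lin lin_is_linear.

Lemma lin_eq0 a : (lin a == 0) = (a == 0).
Proof. by rewrite polfun_eq0 linform_eq0. Qed.

Definition den t : F := \prod_(a <- t) lin a.

Lemma den_neq0 t : 0 \notin t -> den t != 0.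
Proof.
move=> t0; rewrite /den prodf_seq_neq0; apply/allP => a ta /=.
by rewrite lin_eq0; apply: contraNneq t0 => <-.
Qed.

(** The concrete form of R^p_m for the forms in s: repetitions are allowed in
    the list t of factors of the denominator. *)
Definition fracs s p m : F -> Prop := Kspan (fun x => exists f t,
  [/\ (msize f <= p.+1)%N, {subset t <= s}, (size t <= m)%N
     & x = polfun f / den t]).

Lemma fracs_sub s s' p m m' x :
  {subset s <= s'} -> (m <= m')%N -> fracs s p m x -> fracs s' p m' x.
Proof.
move=> ss' mm'; apply: Kspan_sub => _ [f [t [fp ts tm ->]]]; apply: Kspan_mem.
by exists f, t; split=> // [a /ts/ss'|] //; apply: leq_trans tm mm'.
Qed.

(** Adjoining a pole costs nothing in the degree of the numerator. *)
Lemma fracs_div a s p m k x : fracs s p m x ->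
  fracs (a :: s) p (m + k) (x / lin a ^+ k).
Proof.
rewrite mulrC; apply: Kspan_mul => _ [f [t [fp ts tm ->]]]; apply: Kspan_mem.
exists f, (nseq k a ++ t); split=> //.
- move=> b; rewrite mem_cat in_cons mem_nseq => /orP[/andP[_ ->] // | /ts->].
  exact: orbT.
- by rewrite size_cat size_nseq addnC leq_add2r.
- by rewrite /den big_cat /= big_nseq iter_mulr_1 invfM mulrCA.
Qed.

(** * The no-broken-circuit family and its span *)

Definition poly_basis X p : seq F :=
  [seq polfun (inflate 'X_[val m]) | m <- enum {: 'X_{1..(\dim X) < p.+1}}].

(** The elements x / a^k with 0 < k <= m and x in L (m - k): a pole of order k
    along ker a leaves m - k factors for the rest of the denominator. *)
Fixpoint tower a (L : nat -> seq F) m : seq F :=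
  if m is m'.+1 then [seq x / lin a | x <- L m' ++ tower a L m'] else [::].

(** Unfolding the recursion, the lists of forms at which tower is entered are
    the no-broken-circuit sets of s restricted to X: those in which no form of
    s, chosen or not, vanishes where X and the chosen forms before it vanish. *)
Fixpoint nbc X s p m : seq F :=
  if s is a :: s' then
    if (X <= lker a)%VS then [::]
    else nbc X s' p m ++ tower a (nbc (X :&: lker a) s' p) m
  else poly_basis X p.

Lemma mem_tower a L m k x : (k < m)%N -> x \in L (m - k.+1)%N ->
  x / lin a ^+ k.+1 \in tower a L m.
Proof.
elim: m k => // m IH k km Lx /=; rewrite exprSr invfM mulrA.
apply: map_f; rewrite mem_cat; case: k => [|k] in km Lx *.
  by rewrite expr0 divr1; rewrite subn1 /= in Lx; rewrite Lx.
by rewrite IH ?orbT.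
Qed.

(** The degree of the denominator may grow by one in the terms that vanish on X,
    the form u making up for it. *)
Definition reduced X s p m : F -> Prop := Kspan (fun x =>
  x \in nbc X s p m \/
  exists u g, [/\ (X <= lker u)%VS, fracs s p m.+1 g & x = lin u * g]).

(** For v in X with a(v) <> 0, the constant u(v) / a(v) makes u - c a vanish at
    v, and X is spanned by v and X :&: ker a. *)
Lemma annih_cap_ker X a u :
  ~~ (X <= lker a)%VS -> (X :&: lker a <= lker u)%VS ->
  exists c, (X <= lker (u - c *: a))%VS.
Proof.
move=> /subvPn[v Xv]; rewrite memv_ker => av Xau.
exists (u v / a v); apply/subvP => w Xw; rewrite memv_ker.
have : w - (a w / a v) *: v \in lker u.
  apply: (subvP Xau); rewrite memv_cap memvB ?memvZ //= memv_ker.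
  by rewrite linearB linearZ /= subr_eq0; apply/eqP; rewrite -[RHS]mulrA mulVf ?mulr1.
rewrite memv_ker linearB linearZ /= => /eqP uw.
rewrite lfunE /= lfunE /= lfunE /= -uw; apply/eqP; congr (_ - _).
by rewrite /GRing.scale /=; ring.
Qed.

(** Induction on s, for all X.  If the head a vanishes on X then x = a * (x / a)
    already is a term of the second kind.  Otherwise a fraction g / a^k, with a
    not occurring in g, is reduced by induction on k: the induction hypothesis
    for X :&: ker a rewrites g into the restricted family plus terms u * h with u
    vanishing on X :&: ker a, and u is a form vanishing on X plus a multiple of
    a, which cancels one factor a. *)
Lemma fracs_reduced X s p m x :
  0 \notin s -> fracs s p m x -> reduced X s p m x.
Proof.
elim: s X m x => [|a s IH] X m x s0.
  apply: Kspan_sub => _ [f [[|a t] [fp ts _ ->]]]; last by have := ts a (mem_head _ _).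
  rewrite /den big_nil divr1 -(subrK (inflate (restrict X f)) f) rmorphD; apply: KspanD.
    elim/Kspan_ind: (restrict_decomp X fp) => [|c y z [u [h [Xu hp ->]]] IH].
      by rewrite rmorph0; exact: Kspan0.
    rewrite rmorphD /= polfunZ; apply: KspanD => //; apply/KspanZ/Kspan_mem; right.
    exists u, (polfun h); rewrite rmorphM; split=> //; apply: Kspan_mem.
    by exists h, [::]; rewrite /den big_nil divr1.
  rewrite (@mpolywE _ _ p.+1 (restrict X f)) ?(leq_trans (msize_restrict _ _)) //.
  rewrite [inflate _]linear_sum rmorph_sum; apply: Kspan_sum => i _ /=.
  rewrite [inflate _]linearZ polfunZ; apply/KspanZ/Kspan_mem; left.
  by apply/mapP; exists i; rewrite ?mem_enum.
move: s0; rewrite in_cons negb_or eq_sym => /andP[a0 s0].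
have la0 : lin a != 0 by rewrite lin_eq0.
have [Xa|nXa] := boolP (X <= lker a)%VS.
  move=> fx; apply: Kspan_mem; right; exists a, (x / lin a); split=> //.
    rewrite -addn1 -[lin a]expr1; apply: fracs_sub (fracs_div a 1 fx) => // b.
    by rewrite !in_cons => /or3P[]->; rewrite ?orbT.
  by rewrite mulrC divfK.
have key k g : (k <= m)%N -> fracs s p (m - k) g ->
    reduced X (a :: s) p m (g / lin a ^+ k).
  elim: k g => [|k IHk] g km gs.
    rewrite expr0 divr1; rewrite subn0 in gs.
    apply: Kspan_sub (IH X m g s0 gs) => y [yL | [u [h [Xu hs ->]]]].
      by apply: Kspan_mem; left; rewrite /= (negPf nXa) mem_cat yL.
    apply: Kspan_mem; right; exists u, h; split=> //.
    by apply: fracs_sub hs => // b; rewrite in_cons orbC => ->.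
  rewrite mulrC; apply: Kspan_mul (IH (X :&: lker a)%VS _ g s0 gs).
  move=> y [yL | [u [h [Xu hs ->]]]].
    rewrite mulrC; apply: Kspan_mem; left; rewrite /= (negPf nXa) mem_cat.
    by rewrite mem_tower ?orbT.
  (* u - c a gives a term of the second kind, c a one with smaller k. *)
  have [c Xuc] := annih_cap_ker nXa Xu.
  have -> : u = (u - c *: a) + c *: a by rewrite subrK.
  rewrite linearD mulrDl mulrDr; apply: KspanD.
    apply: Kspan_mem; right; exists (u - c *: a), (h / lin a ^+ k.+1).
    split=> //; last by rewrite mulrC mulrA.
    by have := fracs_div a k.+1 hs; rewrite addSn subnK.
  rewrite linearZ -rat_scalerAl -rat_scalerAr; apply: KspanZ.
  have -> : (lin a ^+ k.+1)^-1 * (lin a * h) = h / lin a ^+ k.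
    by rewrite exprS invfM mulrAC [_ * (lin a * h)]mulrA mulVf // mul1r.
  by apply: IHk; rewrite ?(ltnW km) // -subSn // subSS in hs *.
apply: Kspan_sub => _ [f [t [fp ts tm ->]]].
(* Separate the factors a of the denominator from the others. *)
set k := count_mem a t; set t' := filter (predC1 a) t.
have tE : perm_eq t (nseq k a ++ t').
  rewrite -(perm_filterC (pred1 a)) perm_cat2r.
  by have /all_pred1P -> := filter_all (pred1 a) t; rewrite size_filter.
have := tm; rewrite (perm_size tE) size_cat size_nseq => kt.
rewrite /den (perm_big _ tE) big_cat /= big_nseq iter_mulr_1 invfM mulrCA mulrC.
apply: key; first exact: leq_trans (leq_addr _ _) kt.
apply: Kspan_mem; exists f, t'; split=> //; last first.
  by rewrite leq_subRL ?(leq_trans (leq_addr _ _) kt).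
by move=> b; rewrite mem_filter => /andP[/negPf /= ba /ts]; rewrite in_cons ba.
Qed.

Lemma nbc_fracs X s p m x : x \in nbc X s p m -> fracs s p m x.
Proof.
elim: s X m x => [|a s IH] X m x /=.
  case/mapP => i _ ->; apply: Kspan_mem; exists (inflate 'X_[val i]), [::].
  rewrite /den big_nil divr1; split=> //; apply: leq_trans (bmdeg i).
  apply: (@mpolyX_ind _ _ (fun d g => msize (inflate g) <= d.+1)%N) => [|d j g gd].
    by rewrite rmorph1 msize1.
  by rewrite rmorphM /= inflateX; apply: msize_mul1 => //; exact: msize_linform.
case: ifP => // _; rewrite mem_cat => /orP[/IH|].
  by apply: fracs_sub => // b; rewrite in_cons orbC => ->.
elim: m x => //= m IHm x /mapP[y]; rewrite mem_cat => yL ->.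
have: fracs (a :: s) p m y.
  case/orP: yL => [/IH|/IHm] //.
  by apply: fracs_sub => // b; rewrite in_cons orbC => ->.
move=> /(fracs_div a 1); rewrite addn1 expr1; apply: fracs_sub => // b.
by rewrite !in_cons => /or3P[]->; rewrite ?orbT.
Qed.

(** Only the zero form vanishes on all of V, so for X = V there is nothing to
    reduce modulo. *)
Lemma fracs_nbc s p m x : 0 \notin s ->
  fracs s p m x <-> Kspan (fun y => y \in nbc fullv s p m) x.
Proof.
move=> s0; split; last by apply: Kspan_sub => y; exact: nbc_fracs.
move/(fracs_reduced fullv s0); apply: Kspan_sub => y [yL | [u [g [Vu _ ->]]]].
  exact: Kspan_mem.
suff -> : u = 0 by rewrite linear0 mul0r; exact: Kspan0.
by apply/eqP; rewrite -linform_eq0 linform_restr restr_form_eq0.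
Qed.

End Fractions.

(** * Linear independence *)

Section Independence.
Variables (K : fieldType) (V : vectType K).
Local Notation E := 'Hom(V, K^o).
Local Notation S := (symalg K V).
Local Notation F := (ratfun V).
Implicit Types (a u : E) (X Y : {vspace V}) (s t : seq E) (x y : F).

(** The local ring of V at the generic point of X, and its maximal ideal
    [vanish X] below. *)
Definition regular X x : Prop :=
  exists f g : S, restrict X g != 0 /\ x = polfun f / polfun g.

Definition vanish X x : Prop := exists f g : S,
  [/\ restrict X f = 0, restrict X g != 0 & x = polfun f / polfun g].

Lemma restrict_neq0 X (g : S) : restrict X g != 0 -> polfun g != 0.
Proof. by rewrite polfun_eq0; apply: contraNneq => ->; rewrite linear0. Qed.

Lemma regular_pol X (f : S) : regular X (polfun f).
Proof. by exists f, 1; rewrite !rmorph1 oner_eq0 divr1. Qed.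

Lemma regularD X x y : regular X x -> regular X y -> regular X (x + y).
Proof.
move=> [f [g [g0 ->]]] [h [k [k0 ->]]]; exists (f * k + h * g), (g * k).
rewrite !rmorphM mulf_neq0 //= rmorphD !rmorphM.
by rewrite addf_div ?(restrict_neq0 (X := X)).
Qed.

Lemma regularM X x y : regular X x -> regular X y -> regular X (x * y).
Proof.
move=> [f [g [g0 ->]]] [h [k [k0 ->]]]; exists (f * h), (g * k).
by rewrite !rmorphM mulf_neq0 //= mulf_div.
Qed.

Lemma regularZ X c x : regular X x -> regular X (c *: x).
Proof.
by move=> Rx; rewrite ratfun_scaleE; apply: regularM => //; exact: regular_pol.
Qed.

Lemma regular_linV X a : ~~ (X <= lker a)%VS -> regular X (lin a)^-1.
Proof.
by exists 1, (linform a); rewrite restrict_linform restr_form_eq0 rmorph1 mul1r.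
Qed.

Lemma vanishM X x y : vanish X x -> regular X y -> vanish X (x * y).
Proof.
move=> [f [g [f0 g0 ->]]] [h [k [k0 ->]]]; exists (f * h), (g * k).
by rewrite !rmorphM /= f0 mul0r mulf_neq0 //= mulf_div.
Qed.

Lemma vanishB X x y : vanish X x -> vanish X y -> vanish X (x - y).
Proof.
move=> [f [g [f0 g0 ->]]] [h [k [h0 k0 ->]]]; exists (f * k - h * g), (g * k).
rewrite rmorphB !rmorphM /= f0 h0 !mul0r subrr mulf_neq0 //= rmorphB !rmorphM.
by split=> //=; rewrite -[in LHS]mulNr addf_div ?(restrict_neq0 (X := X)) ?mulNr.
Qed.

Lemma vanish_lin X a : (X <= lker a)%VS -> vanish X (lin a).
Proof.
move=> Xa; exists (linform a), 1; rewrite restrict_linform !rmorph1 oner_eq0 divr1.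
by split=> //; apply/eqP; rewrite restr_form_eq0.
Qed.

(** If h / k = f / g with h zero on X and k not, then f vanishes on X because the
    ideal of X is prime, hence on Y.  The denominator k may well vanish on Y,
    which is why x has to be regular there. *)
Lemma vanish_regular X Y x : (Y <= X)%VS -> vanish X x -> regular Y x ->
  vanish Y x.
Proof.
move=> YX [h [k [h0 k0 xE]]] [f [g [g0 xE']]]; exists f, g; split=> //.
apply: (restrict_mono YX); move/eqP: xE; rewrite xE'.
rewrite (eqr_div _ _ (restrict_neq0 g0) (restrict_neq0 k0)) => /eqP.
rewrite -!(rmorphM (@polfun K V)) => /polfun_inj/(congr1 (@restrict K V X)).
rewrite !rmorphM /= h0 mul0r => /eqP.
by rewrite mulf_eq0 (negPf k0) orbF => /eqP.
Qed.

Lemma fracs_regular X s p m x :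
  ~~ has (fun a => X <= lker a)%VS s -> fracs s p m x -> regular X x.
Proof.
move=> /hasPn sX; elim/Kspan_ind => [|c y z [f [t [_ ts _ ->]]] Rz].
  by rewrite -(rmorph0 (@polfun K V)); exact: regular_pol.
apply: regularD => //; apply: regularZ; apply: regularM; first exact: regular_pol.
rewrite /den -prodfV big_seq; elim/big_rec: _ => [|a w ta].
  by rewrite -(rmorph1 (@polfun K V)); exact: regular_pol.
by move=> Rw; apply: regularM => //; apply/regular_linV/sX/ts.
Qed.

Lemma tower_nil a (L : nat -> seq F) m :
  (forall j, L j = [::]) -> tower a L m = [::].
Proof. by move=> L0; elim: m => //= m ->; rewrite L0. Qed.

(** A form vanishing on X stays zero on every flat inside X, so the recursion
    ends in an empty family along all branches. *)
Lemma nbc_nil X s p m : has (fun a => X <= lker a)%VS s -> nbc X s p m = [::].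
Proof.
elim: s X m => //= a s IH X m; case: ifP => //= _ Xs; rewrite IH //=.
apply: tower_nil => j; apply: IH; apply: sub_has Xs => b.
exact/subv_trans/capvSl.
Qed.

(** Coefficients indexed by nat, so that they can be split along a concatenation
    without casts. *)
Definition lincomb (c : nat -> K) (l : seq F) : F :=
  \sum_(0 <= i < size l) c i *: l`_i.

Lemma lincomb_cat c l1 l2 : lincomb c (l1 ++ l2) =
  lincomb c l1 + lincomb (fun i => c (size l1 + i)%N) l2.
Proof.
rewrite /lincomb size_cat (big_cat_nat _ (leq_addr _ _)) //=; congr (_ + _).
  by apply: eq_big_nat => i /andP[_ i1]; rewrite nth_cat i1.
rewrite -{1}[size l1]add0n big_addn addKn; apply: eq_bigr => i _.
by rewrite addnC nth_cat ltnNge leq_addr addKn.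
Qed.

Lemma lincomb_div c a l :
  lincomb c [seq x / lin a | x <- l] = lincomb c l / lin a.
Proof.
rewrite /lincomb size_map mulr_suml; apply: eq_big_nat => i /andP[_ il].
by rewrite (nth_map 0) // rat_scalerAl.
Qed.

Lemma lincomb_regular X c l :
  (forall x, x \in l -> regular X x) -> regular X (lincomb c l).
Proof.
move=> Rl; rewrite /lincomb big_nat; elim/big_rec: _ => [|i x il Rx].
  by rewrite -(rmorph0 (@polfun K V)); exact: regular_pol.
by apply: regularD => //; apply/regularZ/Rl/mem_nth; case/andP: il.
Qed.

Definition free_mod X l : Prop := forall c : nat -> K,
  vanish X (lincomb c l) -> forall i, (i < size l)%N -> c i = 0.

Lemma lincomb_free0 l c :
  (forall i, (i < size l)%N -> c i = 0) -> lincomb c l = 0.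
Proof.
by move=> c0; rewrite /lincomb big_nat big1 // => i /= il; rewrite c0 // scale0r.
Qed.

(** Multiplying a relation x + (y + z) / a by a gives (x a + y) + z, where z is
    the combination of the shorter tower: by induction its coefficients are
    zero.  Then x a + y vanishes on X and is regular on Y, so it vanishes on Y,
    as x a does; hence so does y, and L is free there. *)
Lemma tower_free X a (L : nat -> seq F) (Y := (X :&: lker a)%VS) :
  ~~ (X <= lker a)%VS -> (forall j x, x \in L j -> regular Y x) ->
  (forall j, free_mod Y (L j)) ->
  forall m x c, regular Y x -> vanish X (x + lincomb c (tower a L m)) ->
  forall i, (i < size (tower a L m))%N -> c i = 0.
Proof.
move=> nXa RL FL; have a0 : lin a != 0.
  by rewrite lin_eq0; apply: contraNneq nXa => ->; rewrite -restr_form_eq0 linear0.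
elim=> // m IH x c Rx /=; rewrite lincomb_div lincomb_cat size_map size_cat.
set y := lincomb c _; set c' := fun i => _; set z := lincomb c' _ => Vxyz.
have Ry : regular Y y by apply: lincomb_regular => w; exact: RL.
have Rx' : regular Y (x * lin a + y) by apply/regularD/Ry/regularM/regular_pol.
have Vz : vanish X (x * lin a + y + z).
  have := vanishM Vxyz (regular_pol X (linform a)); rewrite -/(lin a).
  by rewrite mulrDl divfK // addrA.
have c'0 := IH _ _ Rx' Vz.
have Vy : vanish Y y.
  rewrite -[y](addKr (x * lin a)) addrC; apply: vanishB.
    apply: vanish_regular (capvSl _ _) _ Rx'.
    by rewrite -[_ + y]addr0 -(lincomb_free0 c'0).
  by rewrite mulrC; apply: vanishM Rx; apply/vanish_lin/capvSr.
move=> i; case: (ltnP i (size (L m))) => [iL _ | Li iLT]; first exact: FL Vy i iL.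
by rewrite -(subnKC Li); apply: c'0; rewrite -(ltn_add2l (size (L m))) subnKC.
Qed.

(** Restriction to X maps the family back to the monomials, which are free. *)
Lemma poly_basis_free X p : free_mod X (poly_basis X p).
Proof.
move=> c; rewrite /poly_basis /lincomb size_map; set e := enum _.
have -> : \sum_(0 <= i < size e) c i *: [seq polfun (inflate 'X_[val m]) | m <- e]`_i
  = polfun (inflate (\sum_(0 <= i < size e) c i *: 'X_[val (nth bm0 e i)])).
  rewrite [inflate _]linear_sum rmorph_sum; apply: eq_big_nat => i /andP[_ ie].
  by rewrite (nth_map bm0) //= -polfunZ [in RHS]linearZ.
set G := \sum_(_ <= _ < _) _ => -[f [g [f0 g0 /eqP]]].
rewrite -[X in X == _]divr1 eqr_div ?oner_eq0 ?(restrict_neq0 g0) // mulr1.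
rewrite -rmorphM => /eqP/polfun_inj/(congr1 (@restrict K V X)).
rewrite rmorphM /= inflateK f0 => /eqP; rewrite mulf_eq0 (negPf g0) orbF => /eqP G0.
move=> j je; move/(congr1 (mcoeff (val (nth bm0 e j)))): G0.
rewrite mcoeff0 raddf_sum /= big_mkord (bigD1 (Ordinal je)) //= big1 => [|i ij].
  by rewrite mcoeffZ mcoeffX eqxx mulr1 addr0.
rewrite mcoeffZ mcoeffX (inj_eq val_inj) nth_uniq ?enum_uniq //.
by rewrite (negPf (ij : (i : nat) != j)) mulr0.
Qed.

(** The tower comes first and then the family of the tail.  For the tower, the
    combination of the tail family must be regular on X :&: ker a; it is, unless
    a form of the tail vanishes there, and in that case the tower is empty. *)
Lemma nbc_free X s p m : free_mod X (nbc X s p m).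
Proof.
elim: s X m => [|a s IH] X m /=; first exact: poly_basis_free.
case: ifPn => // nXa c; rewrite lincomb_cat size_cat.
set Y := (X :&: lker a)%VS; set L := nbc Y s p.
have [Ys|Ys] := boolP (has (fun b => Y <= lker b)%VS s).
  rewrite tower_nil => [|j]; last exact: nbc_nil.
  by rewrite /lincomb addn0 /= big_nil addr0; exact: IH.
set c' := fun i => c _ => Vc.
have RL Z j x : x \in nbc Z s p j -> regular Y x.
  by move/nbc_fracs; exact: fracs_regular.
have c'0 := tower_free nXa (RL Y) (fun j => IH Y j) (lincomb_regular _ (RL X m)) Vc.
move: Vc; rewrite (lincomb_free0 c'0) addr0 => Vc i.
case: (ltnP i (size (nbc X s p m))) => [iL _ | Li iLT]; first exact: IH Vc i iL.
by rewrite -(subnKC Li); apply: c'0; rewrite -(ltn_add2l (size (nbc X s p m))) subnKC.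
Qed.

Lemma fracs_dimension s p m : 0 \notin s ->
  has_dimension (fracs s p m) (size (nbc fullv s p m)).
Proof.
move=> s0; set l := nbc fullv s p m; exists (fun i => l`_i); split=> [c c0 i|x].
  have V0 : vanish fullv (0 : F).
    by exists 0, 1; rewrite !rmorph1 !linear0 oner_eq0 divr1.
  pose c' j : K := oapp c 0 (insub j).
  have c'E j : c' (val j) = c j by rewrite /c' valK.
  rewrite -c'E; apply: (@nbc_free fullv s p m) (ltn_ord i); rewrite -/l /lincomb.
  by rewrite big_mkord; under eq_bigr => j _ do rewrite c'E; rewrite c0.
rewrite (fracs_nbc p m x s0) -/l; split; last first.
  by move=> [c ->]; apply: Kspan_sum => i _; apply/KspanZ/Kspan_mem/mem_nth.
elim/Kspan_ind => [|c y z yl [d ->]].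
  by exists (fun=> 0); rewrite big1 // => i _; rewrite scale0r.
move: yl; rewrite -index_mem => yl.
exists (fun i => (i == Ordinal yl)%:R * c + d i).
under [RHS]eq_bigr => i _ do rewrite scalerDl.
rewrite big_split /=; congr (_ + _); rewrite (bigD1 (Ordinal yl)) //= big1.
  by rewrite eqxx mul1r addr0 nth_index // -index_mem.
by move=> i /negPf ->; rewrite mul0r scale0r.
Qed.

(** * Clearing common factors *)

Definition den_pol t : S := \prod_(a <- t) linform a.

Lemma den_polE t : polfun (den_pol t) = den t.
Proof. exact: rmorph_prod. Qed.

Lemma Ralg_den (Delta : {fset E}) x : Ralg Delta x ->
  exists f t, {subset t <= Delta} /\ x * den t = polfun f.
Proof.
elim=> [f|a aD|{}x y _ [f [t [tD xE]]] _ [g [u [uD yE]]]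
  |{}x y _ [f [t [tD xE]]] _ [g [u [uD yE]]]].
- by exists f, [::]; rewrite /den big_nil mulr1.
- have [la0|la0] := eqVneq (lin a) 0.
    by exists 0, [::]; rewrite -/(lin a) la0 invr0 mul0r rmorph0.
  exists 1, [:: a]; rewrite /den big_seq1 mulVf // rmorph1; split=> // b.
  by rewrite inE => /eqP ->.
- exists (f * den_pol u + g * den_pol t), (t ++ u); split.
    by move=> b; rewrite mem_cat => /orP[/tD | /uD].
  rewrite rmorphD !rmorphM /= -xE -yE !den_polE /den big_cat /=; ring.
- exists (f * g), (t ++ u); split.
    by move=> b; rewrite mem_cat => /orP[/tD | /uD].
  by rewrite rmorphM /= -xE -yE /den big_cat /=; ring.
Qed.

(** The forms vanishing on ker a are the multiples of a, so the decomposition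
    modulo the ideal of ker a exhibits the quotient. *)
Lemma linform_dvd a (f : S) : restrict (lker a) f = 0 ->
  exists g, f = linform a * g.
Proof.
move=> f0; have := @restrict_decomp K V (lker a) (msize f) f (leqnSn _).
rewrite f0 linear0 subr0; elim/Kspan_ind => [|c y z [u [h [au _ ->]]] [g ->]].
  by exists 0; rewrite mulr0.
suff [d ->] : exists d, u = d *: a.
  exists ((c * d) *: h + g); rewrite linearZ /= -!scalerAl scalerA mulrDr.
  by rewrite -scalerAr.
have [Va|nVa] := boolP (fullv <= lker a)%VS.
  exists 0; rewrite scale0r; apply/eqP; rewrite -linform_eq0 linform_restr restr_form_eq0.
  exact: subv_trans Va au.
have [|d Vu] := @annih_cap_ker K V fullv a u nVa; first by rewrite capfv.
exists d; apply/eqP; rewrite -subr_eq0 -linform_eq0 linform_restr restr_form_eq0.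
exact: Vu.
Qed.

Lemma linform_prime a (f g : S) : a != 0 ->
  (exists h, f * g = linform a * h) ->
  (exists h, f = linform a * h) \/ (exists h, g = linform a * h).
Proof.
move=> a0 [h fgE]; have: restrict (lker a) (f * g) = 0.
  rewrite fgE rmorphM /= restrict_linform; apply/eqP.
  by rewrite mulf_eq0 restr_form_eq0 subvv.
rewrite rmorphM /= => /eqP; rewrite mulf_eq0 => /orP[]/eqP/linform_dvd.
  by left.
by right.
Qed.

Lemma msize_linform_mul a (f : S) : a != 0 -> f != 0 ->
  msize (linform a * f) = (msize f).+1.
Proof.
rewrite -linform_eq0 => a0 f0; rewrite msizeM //.
suff -> : msize (linform a) = 2 by [].
apply/eqP; rewrite eqn_leq msize_linform ltnNge; apply: contra a0 => /msize1_polyC aE.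
have := linformE a 0; rewrite linear0 aE mevalC => ->; exact/eqP/mpolyC0.
Qed.

(** With f / g = h / (product of t), each form a in t divides h g, hence h or g.
    If it divides h, cancel it on the right-hand side; if it divides g, cancel it
    on both sides and put it back into the denominator at the end, where its
    degree is paid for by that of g. *)
Lemma reduce_frac t (f g h : S) p m : 0 \notin t -> g != 0 ->
  f * den_pol t = h * g -> (msize f <= p.+1)%N -> (msize g <= m.+1)%N ->
  exists f' t', [/\ {subset t' <= t}, (msize f' <= p.+1)%N, (size t' <= m)%N
     & polfun f / polfun g = polfun f' / den t'].
Proof.
elim: t f g h m => [|a t IH] f g h m t0 g0; rewrite /den_pol.
  rewrite big_nil mulr1 => fE fp gm; exists h, [::]; split=> //; last first.
    by rewrite /den big_nil divr1 fE rmorphM mulfK // polfun_eq0.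
  have [->|h0] := eqVneq h 0; first by rewrite msize0.
  apply: leq_trans fp; rewrite fE msizeM // -subn1 -addnBA ?leq_addr //.
  by rewrite lt0n msize_poly_eq0.
move: t0; rewrite in_cons negb_or eq_sym big_cons => /andP[a0 t0] fE fp gm.
have la0 : linform a != 0 by rewrite linform_eq0.
have [|[h' hE]|[g' gE]] := @linform_prime a h g a0.
- by exists (f * den_pol t); rewrite -fE mulrCA.
- have fE' : f * den_pol t = h' * g.
    by apply: (mulfI la0); rewrite mulrCA fE hE mulrA.
  have [f' [t' [tt' fp' tm E]]] := IH _ _ _ _ t0 g0 fE' fp gm.
  by exists f', t'; split=> // b /tt'; rewrite in_cons orbC => ->.
- have g'0 : g' != 0 by apply: contraNneq g0 => g'0; rewrite gE g'0 mulr0.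
  have fE' : f * den_pol t = h * g'.
    by apply: (mulfI la0); rewrite mulrCA fE gE mulrCA.
  move: gm; rewrite gE msize_linform_mul // ltnS; case: m => [|m] gm.
    by move: gm; rewrite leqn0 msize_poly_eq0 (negPf g'0).
  have [f' [t' [tt' fp' tm E]]] := IH _ _ _ _ t0 g'0 fE' fp gm.
  exists f', (a :: t'); split=> //.
    by move=> b; rewrite !in_cons => /orP[->|/tt'->]; rewrite ?orbT.
  rewrite rmorphM invfM mulrCA E /den big_cons invfM mulrCA; congr (_ * _).
Qed.

Lemma Rpq_fracs (Delta : {fset E}) (p q : nat) x : 0 \notin Delta ->
  fracs Delta p q x <-> Rpq Delta p q x.
Proof.
move=> D0; have degE (f : S) (r : nat) : deg_le f r = (msize f <= r.+1)%N.
  by rewrite /deg_le -PoszD lez_nat addn1.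
split; apply: Kspan_sub => y.
  move=> [f [t [fp tD tm ->]]]; apply: Kspan_mem; split.
    apply: Ralg_mul; first exact: Ralg_pol.
    rewrite /den -prodfV big_seq; elim/big_rec: _ => [|a w ta Rw].
      by rewrite -(rmorph1 (@polfun K V)); exact: Ralg_pol.
    by apply: Ralg_mul Rw; apply/Ralg_inv/tD.
  exists f, (den_pol t); rewrite !degE den_polE; split=> //.
    by rewrite -polfun_eq0 den_polE den_neq0 //; apply: contra D0 => /tD.
  apply: leq_trans (_ : _ <= (size t).+1)%N _ => //.
  rewrite /den_pol; elim: (t) => [|a t' IH]; first by rewrite big_nil msize1.
  by rewrite big_cons; apply: msize_mul1 => //; exact: msize_linform.
move=> [/Ralg_den[h [t [tD hE]]] [f [g [g0]]]]; rewrite !degE => fp gq yE.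
have t0 : 0 \notin t by apply: contra D0 => /tD.
have fE : f * den_pol t = h * g.
  apply: polfun_inj; rewrite !rmorphM /= -hE den_polE yE.
  by rewrite [RHS]mulrAC divfK ?polfun_eq0.
have [f' [t' [tt' fp' tm E]]] := reduce_frac t0 g0 fE fp gq.
by rewrite yE E; apply: Kspan_mem; exists f', t'; split=> // b /tt'/tD.
Qed.

End Independence.

(** * Counting the family *)

(** The monomials of degree at most p are counted degree by degree, which sums
    binomials along a diagonal of Pascal's triangle. *)
Lemma card_bmultinom n p : #|{: 'X_{1..n < p.+1}}| = 'C(p + n, p).
Proof.
case: n => [|n].
  rewrite addn0 binn; apply/eqP/fintype1P; exists bm0 => m.
  by apply: val_inj; apply/mnmP; case.
pose B e := #|[pred m : 'X_{1..n.+1 < p.+1} | mdeg m == e]|.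
have BE e : (e < p.+1)%N -> B e = 'C(e + n, e).
  move=> ep; rewrite -size_basis /B cardE -(size_map val); apply: perm_size.
  apply: uniq_perm => [||m]; rewrite ?uniq_basis ?map_inj_uniq ?enum_uniq //.
    exact: val_inj.
  rewrite -basis_cover; apply/mapP/idP => [[b]|/eqP me].
    by rewrite mem_enum inE => /eqP <- ->.
  rewrite -me in ep; exists (BMultinom ep) => //.
  by rewrite mem_enum inE /= me.
transitivity (\sum_(e < p.+1) B e)%N.
  rewrite -sum1_card (partition_big (fun m : 'X_{1..n.+1 < p.+1} =>
    Ordinal (bmdeg m)) predT) //; apply: eq_bigr => e _; rewrite sum1_card.
  by apply: eq_card => m; rewrite !inE.
under eq_bigr => e _ do rewrite BE //.
elim: p {B BE} => [|p IH]; first by rewrite big_ord1 !bin0.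
by rewrite big_ord_recr /= IH addSn addnS binS addnC -addSnnS addSn.
Qed.

Section Series.
Implicit Types f : fps2.

Lemma ser_sE f p q : (ser_s * f) p q = if p is p'.+1 then f p' q else 0.
Proof.
have -> : (ser_s * f) p = \sum_(i < p.+1) ser_s i * f (p - i)%N by [].
case: p => [|p]; first by rewrite big_ord1 /ser_s /fpsX mul0r.
rewrite big_ord_recl /ser_s /fpsX mul0r add0r big_ord_recl mul1r big1 ?addr0.
  by rewrite subn1.
by move=> i _; rewrite mul0r.
Qed.

Lemma ser_tE f p q : (ser_t * f) p q = if q is q'.+1 then f p q' else 0.
Proof.
have -> : (ser_t * f) p = \sum_(i < p.+1) ser_t i * f (p - i)%N by [].
rewrite big_ord_recl /ser_t /fpsC /= subn0 big1 ?addr0 => [|i _]; last exact: mul0r.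
have -> : (fpsX int * f p) q = \sum_(i < q.+1) fpsX int i * f p (q - i)%N by [].
case: q => [|q]; first by rewrite big_ord1 /fpsX mul0r.
rewrite big_ord_recl /fpsX mul0r add0r big_ord_recl mul1r big1 ?addr0.
  by rewrite subn1.
by move=> i _; rewrite mul0r.
Qed.

Lemma fps2P (f g : fps2) : (forall p q, f p q = g p q) -> f = g.
Proof.
by move=> fg; apply: boolp.funext => p; apply: boolp.funext => q; exact: fg.
Qed.

Lemma fps2D (f g : fps2) p q : (f + g) p q = f p q + g p q. Proof. by []. Qed.
Lemma fps2N (f : fps2) p q : (- f) p q = - f p q. Proof. by []. Qed.
Lemma fps2_1 p q : (1 : fps2) p q = ((p == 0) && (q == 0))%N%:R.
Proof. by case: p => [|p]; case: q. Qed.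

(** The dimensions in the absence of forms, constant in q. *)
Definition bin_ser d : fps2 := ser_of (fun p _ => 'C(p + d, p)%:Z).

Lemma bin_serE d : bin_ser d * (1 - ser_s) ^+ (d + 1) * (1 - ser_t) = 1.
Proof.
elim: d => [|d IH]; last first.
  rewrite -[RHS]IH [(d.+1 + 1)%N]addSn exprS mulrA; congr (_ * _ * _).
  rewrite mulrBr mulr1 mulrC; apply: fps2P => p q.
  rewrite fps2D fps2N ser_sE /bin_ser /ser_of.
  case: p => [|p]; first by rewrite !bin0 subr0.
  by rewrite [(p.+1 + d.+1)%N]addSn binS PoszD addrK addSnnS.
rewrite expr1 mulrBr mulr1 mulrBr mulr1 [_ * ser_t]mulrC [bin_ser 0 * _]mulrC.
apply: fps2P => p q.
rewrite fps2D [X in _ + X]fps2N ser_tE fps2_1 !fps2D !fps2N !ser_sE /bin_ser /ser_of.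
by case: q => [|q]; case: p => [|p]; rewrite ?fps2D ?fps2N ?ser_sE ?addn0 ?binn //= ?subr0 ?subrr.
Qed.

End Series.

Section Counting.
Variables (K : fieldType) (V : vectType K).
Local Notation E := 'Hom(V, K^o).
Implicit Types (a u : E) (X Y Z : {vspace V}) (s t : seq E).

Lemma dim_cap_ker X a :
  ~~ (X <= lker a)%VS -> \dim X = (\dim (X :&: lker a)).+1.
Proof.
move=> Xa; rewrite -(limg_ker_dim a X) -addn1; congr (_ + _)%N.
apply/eqP; rewrite eqn_leq lt0n dimv_eq0 -lkerE Xa andbT.
by apply: leq_trans (dimvS (subvf _)) _; rewrite dimvf.
Qed.

(** The sum of u^#|B| over the no-broken-circuit sets B of s restricted to X. *)
Fixpoint poin_rec X s : {poly int} :=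
  if s is a :: s' then
    if (X <= lker a)%VS then 0
    else poin_rec X s' + 'X * poin_rec (X :&: lker a) s'
  else 1.

Definition nbc_ser X s : fps2 :=
  ser_of (fun p q => (size (nbc X s p q))%:Z).

Local Notation ser_u := (ser_t * (1 - ser_s) / (1 - ser_t)).
Local Notation ev P := (map_poly intr P).[ser_u].

(** The defining recursion of tower, read on coefficients. *)
Lemma tower_ser a X s : (1 - ser_t) * ser_of (fun p q =>
  (size (tower a (nbc X s p) q))%:Z) = ser_t * nbc_ser X s.
Proof.
apply: fps2P => p q; rewrite mulrBl mul1r fps2D fps2N !ser_tE /ser_of.
case: q => [|q] //=; rewrite size_map size_cat PoszD addrK //.
Qed.

Lemma nbc_serE X s :
  nbc_ser X s * (1 - ser_s) ^+ (\dim X + 1) * (1 - ser_t) = ev (poin_rec X s).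
Proof.
elim: s X => [|a s IH] X /=.
  have -> : nbc_ser X [::] = bin_ser (\dim X).
    apply: fps2P => p q; rewrite /nbc_ser /ser_of /=.
    by rewrite size_map -cardE card_bmultinom.
  by rewrite bin_serE rmorph1 hornerC.
case: ifPn => Xa.
  rewrite rmorph0 horner0; have -> : nbc_ser X (a :: s) = 0; last by rewrite !mul0r.
  by apply: fps2P => p q; rewrite /nbc_ser /ser_of /= Xa.
rewrite rmorphD rmorphM /= map_polyX hornerD hornerM hornerX -!IH.
have -> : nbc_ser X (a :: s) = nbc_ser X s +
    ser_of (fun p q => (size (tower a (nbc (X :&: lker a) s p) q))%:Z).
  by apply: fps2P => p q; rewrite fps2D /nbc_ser /ser_of /= (negPf Xa) size_cat.
have tE := tower_ser a (X :&: lker a)%VS s.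
rewrite (dim_cap_ker Xa) addSn exprS.
rewrite (mulrDl (nbc_ser X s)) (mulrDl (nbc_ser X s * _)); congr (_ + _).
rewrite -(mulKr ser_1t_unit (ser_of _)) tE.
(* Stated for an abstract ring: ring would unfold the power series. *)
have shuffle (R : comNzRingType) (i t g x y z : R) :
  i * (t * g) * (x * y) * z = t * x * i * (g * y * z) by ring.
exact: shuffle.
Qed.

(** * Whitney's theorem *)

(** The sum of (-1)^#|B| phi(Z cut by the kernels of B) over the subsets B of s,
    as a recursion of deletion-restriction type. *)
Fixpoint alt_flats (A : zmodType) (phi : {vspace V} -> A) Z s : A :=
  if s is a :: s' then
    alt_flats phi Z s' - alt_flats phi (Z :&: lker a)%VS s'
  else phi Z.

Definition alt_mobius Y s : int := alt_flats (fun Z => (Z == Y)%:R) fullv s.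

(** The deletion-restriction recursions of both sides match: adding a form that
    vanishes on Z pairs off the subsets with opposite signs, and any other form
    raises the codimension by one. *)
Lemma alt_flats_codim Z s : alt_flats (fun Y => (- 'X) ^+ codimv Y) Z s =
  (- 'X) ^+ codimv Z * poin_rec Z s :> {poly int}.
Proof.
elim: s Z => [|a s IH] Z /=; first by rewrite mulr1.
case: ifPn => Za; first by rewrite (capv_idPl Za) subrr mulr0.
have -> : alt_flats (fun Y => (- 'X) ^+ codimv Y) (Z :&: lker a) s =
  (- 'X) ^+ codimv Z * (- 'X) * poin_rec (Z :&: lker a) s :> {poly int}.
  rewrite IH -exprSr; congr (_ ^+ _ * _); rewrite /codimv (dim_cap_ker Za).
  by rewrite -subSn // -(dim_cap_ker Za) dimvS ?subvf.
by rewrite IH; ring.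
Qed.

(** Sorting the subsets of s by the flat that they cut out; L need only contain
    all these flats. *)
Lemma alt_flats_fibres (A : zmodType) (phi : {vspace V} -> A)
    (L : {fset {vspace V}}) Z s :
  (forall X a, X \in L -> a \in s -> (X :&: lker a)%VS \in L) -> Z \in L ->
  \sum_(Y <- L) phi Y *~ alt_flats (fun X => (X == Y)%:R) Z s = alt_flats phi Z s.
Proof.
elim: s Z => [|a s IH] Z /= Lcap LZ.
  rewrite (bigD1_seq Z) ?fset_uniq //= eqxx mulr1z big1 ?addr0 // => Y /negPf YZ.
  by rewrite eq_sym YZ mulr0z.
rewrite -!IH; first by rewrite -sumrB; apply: eq_bigr => Y _; rewrite mulrzBr.
- by move=> X b XL bs; apply: Lcap; rewrite // in_cons bs orbT.
- by apply: Lcap; rewrite ?mem_head.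
- by move=> X b XL bs; apply: Lcap; rewrite // in_cons bs orbT.
- by [].
Qed.

(** Only forms vanishing on X matter, and the alternating sum over all subsets of
    a nonempty set is zero. *)
Lemma alt_flats_above X Z s : alt_flats (fun Y => (X <= Y)%VS%:R) Z s =
  ((X <= Z)%VS && ~~ has (fun a => X <= lker a)%VS s)%:R :> int.
Proof.
elim: s Z => [|a s IH] Z /=; first by rewrite andbT.
rewrite !IH subv_cap; case: (X <= Z)%VS; case: (X <= lker a)%VS => //=.
  by rewrite subrr.
by rewrite subr0.
Qed.

Section Lattice.
Variable Delta : {fset E}.
Local Notation L := (intersections (arrangement Delta)).

Lemma intersectionsP X : reflect
  (exists2 B : {fset {vspace V}}, (B `<=` arrangement Delta)%fset &
     X = (\bigcap_(H <- B) H)%VS) (X \in L).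
Proof.
apply: (iffP (imfsetP _ _ _ _)) => -[B BA ->]; exists B => //.
  by rewrite -fpowersetE.
by rewrite /= fpowersetE.
Qed.

Lemma fullv_intersections : fullv \in L.
Proof.
by apply/intersectionsP; exists fset0; rewrite ?fsub0set // big_seq_fset0.
Qed.

Lemma cap_intersections X a : X \in L -> a \in Delta -> (X :&: lker a)%VS \in L.
Proof.
move=> /intersectionsP[B BA ->] aD; apply/intersectionsP.
exists (lker a |` B)%fset.
  by rewrite fsubUset fsub1set BA andbT; apply/imfsetP; exists a.
have [aB|aB] := boolP (lker a \in B).
  have -> : (lker a |` B = B)%fset by apply/fsetUidPr; rewrite fsub1set.
  by apply/capv_idPl; rewrite (big_fsetD1 _ aB) capvSl.
by rewrite big_fsetU1 //= capvC.
Qed.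

Lemma intersections_lker X : X \in L -> X != fullv ->
  has (fun a => X <= lker a)%VS Delta.
Proof.
move=> /intersectionsP[B BA ->] nV.
have [B0|[H HB]] := fset_0Vmem B; first by rewrite B0 big_seq_fset0 eqxx in nV.
have /imfsetP[a /= aD HE] := fsubsetP BA _ HB.
by apply/hasP; exists a => //; rewrite -HE (big_fsetD1 _ HB) capvSl.
Qed.

Hypothesis D0 : 0 \notin Delta.

Lemma alt_mobius_sum X : X \in L ->
  \sum_(Y <- L | leL Y X) alt_mobius Y Delta = (X == fullv)%:R.
Proof.
move=> XL; transitivity (alt_flats (fun Y => (X <= Y)%VS%:R : int) fullv Delta).
  rewrite -(alt_flats_fibres _ (L := L)); first last.
  - exact: fullv_intersections.
  - by move=> Y a; exact: cap_intersections.
  rewrite big_mkcond; apply: eq_bigr => Y _; rewrite /leL /alt_mobius.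
  by case: (X <= Y)%VS; rewrite ?mul0rz //= intz.
rewrite alt_flats_above subvf /=; have [->|nV] := eqVneq X fullv; last first.
  by rewrite intersections_lker.
suff -> : has (fun a => fullv <= lker a)%VS Delta = false by [].
apply/hasPn => a aD; rewrite -restr_form_eq0 -linform_restr linform_eq0.
by apply: contraNneq D0 => <-.
Qed.

Lemma codimv_lt X Y : (X <= Y)%VS -> Y != X -> (codimv Y < codimv X)%N.
Proof.
move=> XY YX; apply: ltn_sub2l; last first.
  by rewrite ltnNge; apply: contra YX => dYX; rewrite eq_sym eqEdim XY.
rewrite (@leq_trans (\dim Y)) ?dimvS ?subvf //.
by rewrite ltnNge; apply: contra YX => dYX; rewrite eq_sym eqEdim XY.
Qed.

(** Both functions satisfy the recursion that determines the Moebius function. *)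
Lemma mobiusE X : X \in L -> mobius L X = alt_mobius X Delta.
Proof.
have [n] := ubnP (codimv X); elim: n X => // n IH X Xn XL.
have sumE (f : {vspace V} -> int) : \sum_(Y <- L | leL Y X) f Y =
    f X + \sum_(Y <- L | leL Y X && (Y != X)) f Y.
  rewrite big_mkcond (bigD1_seq X) ?fset_uniq //= {1}/leL subvv; congr (_ + _).
  by rewrite -big_mkcondr; apply: eq_bigl => Y; rewrite andbC.
have rest : \sum_(Y <- L | leL Y X && (Y != X)) mobius L Y =
    \sum_(Y <- L | leL Y X && (Y != X)) alt_mobius Y Delta.
  rewrite big_seq_cond [RHS]big_seq_cond; apply: eq_bigr => Y /and3P[YL XY YX].
  by rewrite IH // (leq_trans (codimv_lt XY YX)) // -ltnS.
have := alt_mobius_sum XL; have [XV|nV] := eqVneq X fullv.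
  rewrite sumE big_pred0 ?addr0 => [->|Y]; first by rewrite XV mobiusT.
  rewrite /leL XV; case: (boolP (fullv <= Y)%VS) => //= /dimvS VY.
  by rewrite eqEdim subvf VY.
move=> H; have := mobius_sum XL nV; rewrite -[RHS]H !sumE rest; exact: addIr.
Qed.

Lemma PoinE : Poin (arrangement Delta) = poin_rec fullv Delta.
Proof.
have := alt_flats_codim fullv Delta; rewrite /codimv subnn mul1r => <-.
rewrite -(alt_flats_fibres _ (L := L)); first last.
- exact: fullv_intersections.
- by move=> Y a; exact: cap_intersections.
rewrite /Poin big_seq [RHS]big_seq; apply: eq_bigr => X XL.
rewrite mobiusE // -/(alt_mobius X Delta) -mulrzl; congr (_ * _).
by rewrite -{1}[alt_mobius X Delta]intz; exact: (rmorph_int (@polyC int)).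
Qed.

End Lattice.

End Counting.

(** * The theorem *)

Lemma has_dimension_iff (K : fieldType) (M : lmodType K) (W W' : M -> Prop) d :
  (forall x, W x <-> W' x) -> has_dimension W d -> has_dimension W' d.
Proof. by move=> WW' [b [bf bW]]; exists b; split=> // x; rewrite -WW'. Qed.

Lemma has_dimension0 (K : fieldType) (M : lmodType K) (W : M -> Prop) :
  (forall x, W x <-> x = 0) -> has_dimension W 0.
Proof.
move=> W0; exists (fun=> 0); split=> [c _ []|x] //; rewrite W0.
by split=> [->|[c ->]]; [exists (fun=> 0) | ]; rewrite big_ord0.
Qed.

Theorem corollary1p3 (K : fieldType) (V : vectType K) (ell : nat)
    (Delta : {fset 'Hom(V, K^o)}) :
  [pchar K] =i pred0 ->
  \dim {:V} = ell ->
  (forall alpha : 'Hom(V, K^o), alpha \in Delta -> alpha != 0) ->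
  (forall alpha beta : 'Hom(V, K^o), alpha \in Delta -> beta \in Delta ->
     alpha != beta -> forall c : K, beta != c *: alpha) ->
  exists d : int -> int -> nat,
    (forall p q : int, has_dimension (Rpq Delta p q) (d p q)) /\
    let s := ser_s in let t := ser_t in
    ser_of (fun p q : nat => (d p q)%:Z) =
      (1 - s) ^- (ell + 1) * (1 - t)^-1 *
      (map_poly intr (Poin (arrangement Delta))).[t * (1 - s) / (1 - t)].
Proof.
move=> _ <- Dneq0 _.
have D0 : 0 \notin Delta by apply/negP => /Dneq0; rewrite eqxx.
exists (fun p q => match p, q with
  | Posz p', Posz q' => size (nbc fullv Delta p' q')
  | _, _ => 0%N end); split=> [[p|p] [q|q]|s t].
- apply: has_dimension_iff (fracs_dimension p q D0) => x; exact: Rpq_fracs.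
- by apply: has_dimension0 => x; apply: Rpq_neg; right.
- by apply: has_dimension0 => x; apply: Rpq_neg; left.
- by apply: has_dimension0 => x; apply: Rpq_neg; left.
have mulr_divK (R : comUnitRingType) (x y z : R) : y \is a GRing.unit ->
  z \is a GRing.unit -> x = y^-1 * z^-1 * (x * y * z).
  move=> Uy Uz; rewrite -invrM // mulrC -mulrA [y * z]mulrC.
  by rewrite mulrK // unitrM Uz Uy.
rewrite PoinE // -nbc_serE.
by apply: mulr_divK; rewrite ?unitrX ?ser_1s_unit ?ser_1t_unit.
Qed.
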